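(* Let $G_\phi$ be a signed-regular signed graph with universal sink $q$, such that each nonsink vertex is incident to $m$ edges, with $m_-$ of them negative. Let $m'=m(2m_-+1)-1$. Then $m'\vec{1}$ is a critical configuration, where $\vec{1}$ is the all-ones vector. Furthermore, if $G_\phi=-G$ (all edges not incident to the sink are negative), then every stable configuration $\vec{c}\in S^+$ satisfies $\vec{c}\le m'\vec{1}$ entrywise.
   Context: A signed graph $G_\phi$ is a finite simple graph $G=(V,E)$ with a sign function $\phi:E\to\{+,-\}$. A vertex $q$ is chosen as sink and $v_1,\dots,v_n$ are the other (nonsink) vertices. The sink is universal if it is adjacent to every other vertex. $G_\phi$ is signed-regular if the number of positive edges and the number $m_-$ of negative edges incident to $v$ are the same for all nonsink vertices $v$; here signs are taken into account only for edges between nonsink vertices, so $m_-$ counts negative edges joining $v$ to other nonsink vertices (edges to the sink may be regarded as positive, since their signs do not affect the reduced Laplacian). The number $m$ is the full degree of each nonsink vertex in $G$, including the edge to $q$; thus if $G_\phi=-G$ then $m_-=m-1$. The reduced signed Laplacian $L=L_{G_\phi}$ is the $n\times n$ matrix with $L_{ii}=\deg_G(v_i)$ (counting edges to $q$) and, for $i\neq j$, $L_{ij}=-1$ if $v_iv_j$ is a positive edge, $+1$ if it is a negative edge, $0$ if it is not an edge. $M=L_G$ is the same matrix for the all-positive signing. Both are invertible and $M^{-1}$ has nonnegative entries. The valid configurations are $S^+=\{\vec{c}\in\mathbb{Z}^n: ML^{-1}\vec{c}\ge\vec{0}\}$. For $\vec{c}\in S^+$: site $i$ is ready to fire if $\vec{c}-L\vec{e}_i\in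 S^+$, and replacing $\vec{c}$ by $\vec{c}-L\vec{e}_i$ is then a legal firing; $\vec{c}$ is stable if no site is ready to fire; $\vec{c}$ is reachable if there is $\vec{d}\in S^+$ at which every site is ready to fire and from which $\vec{c}$ is obtained by a finite sequence of legal firings; $\vec{c}$ is critical if it lies in $S^+$ and is stable and reachable. *)

(* Defs.v *)
From mathcomp Require Import all_boot all_order all_algebra.
Set Implicit Arguments.
Unset Strict Implicit.
Unset Printing Implicit Defensive.
Import Order.TTheory GRing.Theory Num.Theory.
Local Open Scope ring_scope.

(* The sign of an edge {u, v} is - when [negative u v] and + otherwise; the
   values of [negative] on non-adjacent pairs are never used. *)
Record signed_graph (V : finType) := SignedGraph {
  adj : rel V;
  negative : rel V;
  adj_sym : symmetric adj;
  adj_irr : irreflexive adj;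
  negative_sym : symmetric negative
}.

Section SignedGraphs.
Variables (V : finType) (G : signed_graph V) (q : V).

Definition deg (x : V) : nat := #|[set y | adj G x y]|.

Definition pos_edge : rel V := [rel x y | adj G x y && ~~ negative G x y].
Definition neg_edge : rel V := [rel x y | adj G x y && negative G x y].

(* Signs count only on edges between nonsink vertices. *)
Definition pos_deg (x : V) : nat := #|[set y | (y != q) && pos_edge x y]|.
Definition neg_deg (x : V) : nat := #|[set y | (y != q) && neg_edge x y]|.

Definition universal_sink : Prop := forall x, x != q -> adj G q x.

Definition signed_regular : Prop :=
  forall x y, x != q -> y != q ->
    pos_deg x = pos_deg y /\ neg_deg x = neg_deg y.

(* G_phi = -G *)
Definition all_negative_off_sink : Prop :=
  forall x y, x != q -> y != q -> adj G x y -> negative G x y.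

(* v_0, ..., v_(n-1) lists the nonsink vertices, without repetition. *)
Definition nonsink_labelling (n : nat) (v : 'I_n -> V) : Prop :=
  injective v /\ forall x, (x \in codom v) = (x != q).

Definition all_positive : signed_graph V :=
  SignedGraph (negative := [rel _ _ | false]) (adj_sym G) (adj_irr G)
    (fun _ _ => erefl).

End SignedGraphs.

Definition reduced_laplacian (V : finType) (G : signed_graph V) (n : nat)
    (v : 'I_n -> V) : 'M[int]_n :=
  \matrix_(i, j)
    if i == j then (deg G (v i))%:Z
    else if pos_edge G (v i) (v j) then -1
    else if neg_edge G (v i) (v j) then 1
    else 0.

Section Chips.
Variables (V : finType) (G : signed_graph V) (n : nat) (v : 'I_n -> V).
Implicit Types c d : 'cV[int]_n.

Let L : 'M[int]_n := reduced_laplacian G v.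
Let M : 'M[int]_n := reduced_laplacian (all_positive G) v.

(* [invmx] is the actual inverse only when L is invertible, which holds in
   particular when the sink is universal (strict diagonal dominance). *)
Definition valid c : bool :=
  let x : 'cV[rat]_n :=
    map_mx intr M *m invmx (map_mx intr L) *m map_mx intr c in
  [forall i, 0 <= x i 0].

Definition fire (i : 'I_n) c : 'cV[int]_n := c - L *m delta_mx i 0.

Definition ready c (i : 'I_n) : bool := valid (fire i c).

Definition stable c : bool := [forall i, ~~ ready c i].

Definition legal_firing c d : bool :=
  valid c && [exists i, ready c i && (d == fire i c)].

Definition reachable c : Prop :=
  exists d (s : seq 'cV[int]_n),
    [/\ valid d, (forall i, ready d i), path legal_firing d s & last d s = c].

Definition critical c : Prop := [/\ valid c, stable c & reachable c].

End Chips.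

(* Main.v *)
Require Import Defs.
From mathcomp Require Import all_boot all_order all_algebra.
From mathcomp Require Import ring lra.
Set Implicit Arguments.
Unset Strict Implicit.
Unset Printing Implicit Defensive.
Import Order.TTheory GRing.Theory Num.Theory.
Local Open Scope ring_scope.

(** The whole argument is run on the potential x = L^-1 c of a configuration c,
a rational vector.  In terms of x, validity reads M x >= 0, and firing site i
subtracts the i-th basis vector from x.  Since M has nonpositive off-diagonal
entries, a valid configuration is ready at i exactly when (M x)_i >= deg v_i
([ready_potentialE]): firing i can only hurt site i itself.

A universal sink gives each nonsink vertex 1 + m_+ + m_- = m neighbours, so L
maps the all-ones vector 1 to (2 m_- + 1) 1, and M fixes 1.  Hence m' 1 has
potential (m - eps) 1 with eps = 1 / (2 m_- + 1) in ]0, 1], which is also M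
times its potential.  It is nonnegative, so m' 1 is valid, and less than m, so
m' 1 is stable.  For reachability, start from m' 1 + L 1 and fire every site
once.  When the sites of r remain to be fired, the potential is m - eps plus
the indicator of r; its image by M is at least 1 - eps >= 0 everywhere
([unfired_valid]), so every configuration on the way is valid, and the order of
the firings is irrelevant, whence every site is ready at the start.

For -G, a stable valid configuration satisfies M x < m, hence x < m by a
maximum principle ([max_principle]).  All entries of L are nonnegative now, so
c_i = m x_i + (sum of x over the m - 1 nonsink neighbours) < m (2 m - 1), and
the integer c_i is at most m (2 m_- + 1) - 1 ([stable_bound]). *)

(** * Linear algebra and counting *)

(** A kernel vector u cannot satisfy the equation of row i when |u_i| is
maximal: the off-diagonal terms are too small to cancel the diagonal one. *)
Lemma dominant_unitmx (F : realFieldType) (n : nat) (A : 'M[F]_n) :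
  (forall i, \sum_(j | j != i) `|A i j| < `|A i i|) -> A \in unitmx.
Proof.
move=> domA; rewrite -unitmx_tr -row_free_unit -kermx_eq0.
apply/rowV0P => u /sub_kermxP uA0; apply/rowP => k; rewrite mxE.
apply/eqP; apply/negPn/negP => uk_neq0.
have [i _ max_i] := @arg_maxP _ _ _ k xpredT (fun i => `|u 0 i|) isT.
have ui_gt0 : 0 < `|u 0 i|.
  by apply: lt_le_trans (max_i k isT); rewrite normr_gt0.
have := congr1 (fun w : 'rV_n => w 0 i) uA0; rewrite !mxE (bigD1 i) //= mxE.
move=> /(canRL (addrK _)); rewrite sub0r => /(congr1 Num.norm).
rewrite normrN normrM => eq_i.
have : `|\sum_(j | j != i) u 0 j * A^T j i| <= `|u 0 i| * \sum_(j | j != i) `|A i j|.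
  apply: le_trans (ler_norm_sum _ _ _) _; rewrite mulr_sumr.
  by apply: ler_sum => j _; rewrite mxE normrM ler_wpM2r //; apply: max_i.
by rewrite -eq_i ler_pM2l // leNgt domA.
Qed.

Section Labelling.
Variables (V : finType) (q : V) (n : nat) (v : 'I_n -> V).
Hypothesis v_labels : nonsink_labelling q v.

Lemma label_neq i : v i != q.
Proof. by rewrite -v_labels.2 codom_f. Qed.

Lemma card_labels (P : pred V) :
  #|[pred j | P (v j)]| = #|[set y | (y != q) && P y]|.
Proof.
rewrite -(card_image v_labels.1); apply: eq_card => y; rewrite inE.
apply/imageP/andP => [[j Pj ->]|[y_neq Py]]; first by rewrite label_neq.
have /codomP[j def_y] : y \in codom v by rewrite v_labels.2.
by exists j; rewrite // inE -def_y.
Qed.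

End Labelling.

(** * Reduced Laplacians and potentials *)

Section Laplacian.
Variables (V : finType) (G : signed_graph V) (q : V) (n : nat) (v : 'I_n -> V).
Hypothesis v_labels : nonsink_labelling q v.
Hypothesis q_universal : universal_sink G q.

Let L : 'M[rat]_n := map_mx intr (reduced_laplacian G v).
Let M : 'M[rat]_n := map_mx intr (reduced_laplacian (all_positive G) v).

Lemma deg_universal i :
  deg G (v i) = (pos_deg G q (v i) + neg_deg G q (v i)).+1.
Proof.
rewrite /deg (cardsD1 q) inE adj_sym q_universal ?(label_neq v_labels) //.
rewrite add1n /pos_deg /neg_deg; congr _.+1.
rewrite -(cardsID [set y | negative G (v i) y]) addnC.
by congr (_ + _)%N; apply: eq_card => y; rewrite !inE -?andbA 1?andbC -?andbA.
Qed.

(** The predecessor discounts the sink. *)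
Lemma card_adj_labels i : #|[pred j | adj G (v i) (v j)]| = (deg G (v i)).-1.
Proof.
rewrite (card_labels v_labels (fun y => adj G (v i) y)).
rewrite /deg [in RHS](cardsD1 q) inE adj_sym q_universal ?(label_neq v_labels) //.
by rewrite add1n; apply: eq_card => y; rewrite !inE.
Qed.

Lemma laplacian_mulE (H : signed_graph V) (x : 'cV[rat]_n) i :
  ((map_mx intr (reduced_laplacian H v) : 'M[rat]_n) *m x) i 0 =
  (deg H (v i))%:R * x i 0
  + \sum_(j | adj H (v i) (v j)) (-1) ^+ (~~ negative H (v i) (v j)) * x j 0.
Proof.
rewrite !mxE (bigD1 i) //= !mxE eqxx; congr (_ + _).
rewrite [RHS]big_mkcond [RHS](bigD1 i) //= adj_irr add0r.
apply: eq_bigr => j j_neq; rewrite !mxE eq_sym (negPf j_neq) /pos_edge /neg_edge /=.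
by case: (adj H _ _); case: (negative H _ _); rewrite ?mul0r ?mul1r ?expr1 ?rmorphN1.
Qed.

Lemma positive_laplacian_mulE (x : 'cV[rat]_n) i :
  (M *m x) i 0 = (deg G (v i))%:R * x i 0 - \sum_(j | adj G (v i) (v j)) x j 0.
Proof.
rewrite laplacian_mulE -sumrN; congr (_ + _).
by apply: eq_bigr => j _; rewrite /= expr1 mulN1r.
Qed.

(** Row i of L sums to deg - m_+ + m_-, and deg = 1 + m_+ + m_-. *)
Lemma laplacian_const (a : rat) i :
  (L *m (const_mx a : 'cV_n)) i 0 = (2 * neg_deg G q (v i) + 1)%N%:R * a.
Proof.
rewrite laplacian_mulE mxE (bigID (fun j => negative G (v i) (v j))) /=.
rewrite (eq_bigr (fun=> a)); last by move=> j /andP[_ ->]; rewrite mxE mul1r.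
rewrite [X in _ + (_ + X)](eq_bigr (fun=> - a)); last first.
  by move=> j /andP[_ ->]; rewrite mxE mulN1r.
rewrite !sumr_const (card_labels v_labels (neg_edge G (v i))).
rewrite (card_labels v_labels (pos_edge G (v i))).
rewrite -/(neg_deg G q (v i)) -/(pos_deg G q (v i)) deg_universal.
by rewrite mulNrn -!(mulr_natl a) -[(_ + _)%N.+1]addn1 !natrD; ring.
Qed.

(** The edge to the sink counts on the diagonal only, so the diagonal is
strictly dominant; this makes [invmx] the actual inverse. *)
Lemma laplacian_unitmx : L \in unitmx.
Proof.
apply: dominant_unitmx => i; rewrite !mxE eqxx ger0_norm ?ler0n //.
have -> : \sum_(j | j != i) `|L i j| = ((deg G (v i)).-1)%:R.
  rewrite -card_adj_labels -sum1_card natr_sum big_mkcond [RHS]big_mkcond.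
  apply: eq_bigr => j _; rewrite !mxE inE eq_sym.
  have [->|_] := eqVneq i j; first by rewrite adj_irr.
  rewrite /pos_edge /neg_edge /=.
  by case: (adj G _ _); case: (negative G _ _); rewrite ?normr0 ?normr1 ?rmorphN1 ?normrN1.
by rewrite ltr_nat deg_universal.
Qed.

(** At a site i where x is maximal, replacing the neighbouring values in
(M x)_i by x_i can only decrease it and leaves x_i, as row i of M sums to 1. *)
Lemma max_principle (x : 'cV[rat]_n) (b : rat) :
  (forall i, (M *m x) i 0 < b) -> forall i, x i 0 < b.
Proof.
move=> Mx_lt k.
have [i _ max_i] := @arg_maxP _ _ _ k xpredT (fun i => x i 0) isT.
apply: le_lt_trans (max_i k isT) (le_lt_trans _ (Mx_lt i)).
rewrite positive_laplacian_mulE.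
have : \sum_(j | adj G (v i) (v j)) x j 0 <= x i 0 *+ (deg G (v i)).-1.
  by rewrite -card_adj_labels -sumr_const; apply: ler_sum => j _; apply: max_i.
rewrite deg_universal /=; set d := (pos_deg _ _ _ + _)%N.
by rewrite -(mulr_natl (x i 0)) -(@natr1 _ d) => ?; lra.
Qed.

(** The potential x is an argument, rather than [invmx] applied to c, so that
explicit potentials can be used. *)
Lemma valid_potentialE (c : 'cV[int]_n) (x : 'cV[rat]_n) :
  map_mx intr c = L *m x -> valid G v c = [forall i, 0 <= (M *m x) i 0].
Proof.
move=> cE; rewrite /valid cE -mulmxA [invmx _ *m _]mulmxA.
by rewrite mulVmx ?laplacian_unitmx // mul1mx.
Qed.

Lemma potentialP (c : 'cV[int]_n) : exists x : 'cV[rat]_n, map_mx intr c = L *m x.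
Proof. by exists (invmx L *m map_mx intr c); rewrite mulKVmx ?laplacian_unitmx. Qed.

Lemma fire_potential (c : 'cV[int]_n) (x : 'cV[rat]_n) i :
  map_mx intr c = L *m x ->
  map_mx intr (fire G v i c) = L *m (x - delta_mx i 0).
Proof. by move=> cE; rewrite /fire map_mxB cE map_mxM map_delta_mx mulmxBr. Qed.

(** Firing i subtracts column i of M from M x, which decreases no entry
but the i-th, so that only the i-th can become negative. *)
Lemma ready_potentialE (c : 'cV[int]_n) (x : 'cV[rat]_n) i :
  map_mx intr c = L *m x -> valid G v c ->
  ready G v c i = ((deg G (v i))%:R <= (M *m x) i 0).
Proof.
move=> cE; rewrite (valid_potentialE cE) => /forallP Mx_ge0.
rewrite /ready (valid_potentialE (fire_potential i cE)).
have ME j : (M *m (x - delta_mx i 0)) j 0 = (M *m x) j 0 - M j i.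
  by rewrite mulmxBr -colE mxE [(- col i M) j 0]mxE [col i M j 0]mxE.
have Mii : M i i = (deg G (v i))%:R by rewrite !mxE eqxx.
apply/forallP/idP => [/(_ i)|le_i j]; rewrite ME.
  by rewrite Mii subr_ge0.
have [->|j_neq] := eqVneq j i; first by rewrite Mii subr_ge0.
apply: addr_ge0 (Mx_ge0 j) _; rewrite oppr_ge0 !mxE (negPf j_neq).
by rewrite /pos_edge /neg_edge /=; case: (adj G _ _).
Qed.

End Laplacian.

(** * Signed-regular graphs *)

Section Regular.
Variables (V : finType) (G : signed_graph V) (q : V) (n : nat) (v : 'I_n -> V).
Variables m m_neg : nat.
Hypothesis v_labels : nonsink_labelling q v.
Hypothesis q_universal : universal_sink G q.
Hypothesis degG : forall x, x != q -> deg G x = m.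
Hypothesis neg_degG : forall x, x != q -> neg_deg G q x = m_neg.

Let L : 'M[rat]_n := map_mx intr (reduced_laplacian G v).
Let M : 'M[rat]_n := map_mx intr (reduced_laplacian (all_positive G) v).
Let m' : int := m%:Z * (2 * m_neg%:Z + 1) - 1.
Let eps : rat := (2 * m_neg + 1)%N%:R^-1.
Let a : rat := m%:R - eps.

(** The configuration from which firing the sites of r, each as often as it is
listed, leads to m' 1. *)
Definition unfired (r : seq 'I_n) : 'cV[int]_n :=
  const_mx m' + reduced_laplacian G v *m \sum_(i <- r) delta_mx i 0.

Lemma unfired_nil : unfired [::] = const_mx m'.
Proof. by rewrite /unfired big_nil mulmx0 addr0. Qed.

Lemma fire_unfired i r : fire G v i (unfired (i :: r)) = unfired r.
Proof. by rewrite /fire /unfired big_cons mulmxDr addrCA [_ + _ - _]addrC addKr. Qed.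

Lemma unfired_potential r :
  map_mx intr (unfired r) = L *m (const_mx a + \sum_(i <- r) delta_mx i 0).
Proof.
rewrite /unfired map_mxD mulmxDr map_mxM.
congr (_ + L *m _); last first.
  by rewrite map_mx_sum; apply: eq_bigr => i _; rewrite map_delta_mx.
apply/colP => i; rewrite (laplacian_const v_labels q_universal) !mxE.
rewrite neg_degG ?(label_neq v_labels) // mulrBr mulfV; last first.
  by rewrite pnatr_eq0 addn1.
by rewrite /m' /= rmorphB rmorphM rmorphD rmorphM natrD natrM /= mulrC.
Qed.

Lemma eps_bounds : 0 < eps /\ eps <= 1.
Proof. by rewrite /eps invr_gt0 ltr0n addn1 invf_le1 ?ltr0n // ler1n. Qed.

(** The potential is m - eps off r and m + 1 - eps on r.  Bounding the m - 1
neighbouring values by m + 1 - eps, the entry of M x at a site of r is at least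
m + 1 - eps, and at any other site it is at least
m (m - eps) - (m - 1) (m + 1 - eps) = 1 - eps. *)
Lemma unfired_valid r : uniq r -> valid G v (unfired r).
Proof.
move=> r_uniq; rewrite (valid_potentialE v_labels q_universal (unfired_potential r)).
apply/forallP => i.
have xE j : (const_mx a + \sum_(k <- r) delta_mx k 0 : 'cV_n) j 0 = a + (j \in r)%:R.
  rewrite !mxE summxE -(count_uniq_mem j r_uniq) -sum1_count natr_sum [in RHS]big_mkcond /=.
  by congr (_ + _); apply: eq_bigr => k _; rewrite mxE eqxx andbT eq_sym; case: eqP.
rewrite (positive_laplacian_mulE _ _) xE.
have : \sum_(j | adj G (v i) (v j)) (const_mx a + \sum_(k <- r) delta_mx k 0 : 'cV_n) j 0
       <= (a + 1) *+ (deg G (v i)).-1.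
  rewrite -(card_adj_labels v_labels q_universal) -sumr_const.
  by apply: ler_sum => j _; rewrite xE lerD2l; case: (j \in r).
have := deg_universal v_labels q_universal i.
rewrite degG ?(label_neq v_labels) // => m_eq.
have [eps_gt0 eps_le1] := eps_bounds.
rewrite /a m_eq; set k := (pos_deg _ _ _ + _)%N => /=.
rewrite -(mulr_natl (_ + 1)) -(@natr1 _ k); move: (\sum_(j | _) _) => sum_nbr sum_le.
have k_ge0 : 0 <= k%:R :> rat by [].
by case: (i \in r) => /=; lra.
Qed.

Lemma unfired_path r : uniq r -> exists s,
  path (legal_firing G v) (unfired r) s /\ last (unfired r) s = const_mx m'.
Proof.
elim: r => [_|i r IHr r_uniq]; first by exists [::]; rewrite /= unfired_nil.
have /andP[_ r'_uniq] := r_uniq.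
have [s [s_path s_last]] := IHr r'_uniq.
exists (unfired r :: s); split=> //=; rewrite s_path andbT /legal_firing.
rewrite unfired_valid //=; apply/existsP; exists i.
by rewrite /ready fire_unfired unfired_valid ?eqxx.
Qed.

(** Stability is m - eps < m.  Reachability starts from [unfired (enum 'I_n)],
where each site is ready because it may be put first in the list. *)
Lemma const_critical : critical G v (const_mx m').
Proof.
have valid_m' : valid G v (const_mx m') by rewrite -unfired_nil unfired_valid.
split=> //.
  apply/forallP => i.
  have potE : map_mx intr (const_mx m' : 'cV[int]_n) = L *m const_mx a.
    by have := unfired_potential [::]; rewrite unfired_nil big_nil addr0.
  rewrite (ready_potentialE v_labels q_universal i potE) // -ltNge positive_laplacian_mulE mxE.
  rewrite (eq_bigr (fun=> a)) => [|j _]; last by rewrite mxE.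
  rewrite sumr_const (card_adj_labels v_labels q_universal).
  have := deg_universal v_labels q_universal i.
  have [eps_gt0 _] := eps_bounds.
  rewrite /a degG ?(label_neq v_labels) // => ->.
  set k := (pos_deg _ _ _ + _)%N => /=.
  by rewrite -(mulr_natl (k.+1%:R - _)) -(@natr1 _ k); lra.
have [s [s_path s_last]] := unfired_path (enum_uniq 'I_n).
exists (unfired (enum 'I_n)), s; split=> // [|i].
  by rewrite unfired_valid ?enum_uniq.
have perm_i := perm_to_rem (mem_enum 'I_n i).
have -> : unfired (enum 'I_n) = unfired (i :: rem i (enum 'I_n)).
  by rewrite /unfired (perm_big _ perm_i).
by rewrite /ready fire_unfired unfired_valid ?rem_uniq ?enum_uniq.
Qed.

Lemma stable_bound (c : 'cV[int]_n) i :
  all_negative_off_sink G q -> valid G v c -> stable G v c -> c i 0 <= m'.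
Proof.
move=> negG c_valid /forallP c_stable.
have [x cE] := potentialP v_labels q_universal c.
have x_lt : forall j, x j 0 < m%:R.
  apply: (max_principle v_labels q_universal) => j; rewrite ltNge.
  by have := c_stable j; rewrite (ready_potentialE v_labels q_universal j cE) // degG ?(label_neq v_labels).
(* Only the edge to the sink is not negative. *)
have m_eq : m = m_neg.+1.
  have pos0 : pos_deg G q (v i) = 0%N.
    apply: eq_card0 => y; rewrite inE /pos_edge /=.
    apply/negP => /and3P[y_neq vy_adj /negP[]].
    by apply: negG vy_adj; rewrite ?(label_neq v_labels).
  have := deg_universal v_labels q_universal i.
  by rewrite pos0 degG ?neg_degG ?(label_neq v_labels).
have c_sum : (c i 0)%:~R = m%:R * x i 0 + \sum_(j | adj G (v i) (v j)) x j 0.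
  have := congr1 (fun w : 'cV_n => w i 0) cE; rewrite mxE laplacian_mulE => ->.
  rewrite degG ?(label_neq v_labels) //; congr (_ + _).
  by apply: eq_bigr => j ij_adj; rewrite negG ?(label_neq v_labels) // mul1r.
have sum_le : \sum_(j | adj G (v i) (v j)) x j 0 <= m%:R *+ m_neg.
  have <- : #|[pred j | adj G (v i) (v j)]| = m_neg.
    by rewrite (card_adj_labels v_labels q_universal) degG ?(label_neq v_labels) // m_eq.
  by rewrite -sumr_const; apply: ler_sum => j _; apply/ltW/x_lt.
(* Being an integer, c_i need only be less than m (2 m_- + 1). *)
rewrite /m' lerBrDr -ltzD1 ltrD2r -(ltr_int rat) c_sum.
rewrite !rmorphM !rmorphD !rmorphM /=.
have := x_lt i; move: sum_le; rewrite -mulr_natl.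
have -> : (m%:~R : rat) = m_neg%:R + 1 by rewrite natr1 m_eq.
have -> : (m%:R : rat) = m_neg%:R + 1 by rewrite natr1 m_eq.
have : 0 <= m_neg%:R :> rat by [].
move=> k_ge0 sum_le xi_lt.
have : (m_neg%:R + 1) * x i 0 < (m_neg%:R + 1) * (m_neg%:R + 1) :> rat.
  by rewrite ltr_pM2l // ltr_wpDl.
lra.
Qed.

End Regular.

Theorem corollary3p14 (V : finType) (G : signed_graph V) (q : V)
    (n : nat) (v : 'I_n -> V) (m m_neg : nat)
    (v_labels : nonsink_labelling q v)
    (q_universal : universal_sink G q)
    (G_regular : signed_regular G q)
    (degG : forall x, x != q -> deg G x = m)
    (neg_degG : forall x, x != q -> neg_deg G q x = m_neg) :
  let m' : int := m%:Z * (2 * m_neg%:Z + 1) - 1 in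
  critical G v (const_mx m') /\
  (all_negative_off_sink G q ->
   forall c : 'cV[int]_n, valid G v c -> stable G v c ->
   forall i, c i 0 <= m').
Proof.
split=> [|negG c c_valid c_stable i].
  exact: (const_critical v_labels q_universal degG neg_degG).
exact: (stable_bound v_labels q_universal degG neg_degG).
Qed.
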